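(* Let $f:\mathbb{R}^n\to\mathbb{R}$ be convex and $L$-smooth with a minimizer $x^\star$. Let $\mathcal{P},\mathcal{B}\subseteq\mathbb{R}^{n\times n}$ be closed convex sets with $0\in\mathcal{P}$, $L^{-1}I\in\mathcal{P}$, $\operatorname{diam}(\mathcal{P})\le D<\infty$, $\tfrac12I\in\mathcal{B}$, $\operatorname{diam}(\mathcal{B})\le D$. Let $\omega,\tau>0$. Then there is a constant $C$ depending only on $L,D,\omega,\tau,n$ and, for each $K\ge1$, a stepsize $\eta>0$ such that the sequences generated by HDM-HB (see context) with $\eta_p=\eta_b=\eta$ satisfy the following. Let $$\gamma_K^\star:=-\min_{(P,B)\in\mathcal{P}\times\mathcal{B}}\frac1K\sum_{k=1}^Kh_{x^k,x^{k}_-}(P,B),\qquad \rho_K:=\sum_{k=1}^Kh_{x^k,x^k_-}(P_k,B_k)-\min_{(P,B)\in\mathcal{P}\times\mathcal{B}}\sum_{k=1}^Kh_{x^k,x^k_-}(P,B),$$ $$V:=\min\Big\{\frac{f(x^1)-f(x^\star)}{4\Delta^2},\frac{\tau}{4\omega}\Big\},\qquad \Delta:=\max_{x:\,f(x)\le f(x^1)}\ \min_{x^\star\in\mathcal{X}^\star}\|x-x^\star\|.$$ Then $\rho_K\le C\sqrt K$ and $$f(x^{K+1})-f(x^\star)\le\frac{f(x^1)-f(x^\star)}{KV\max\{\gamma_K^\star-\frac{\rho_K}{K},0\}+1}.$$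
   Context: $\|\cdot\|$ is the Euclidean norm, $\operatorname{diam}$ is taken in the Frobenius norm, $\Pi$ denotes orthogonal projection. $L$-smooth means $\nabla f$ is $L$-Lipschitz. $\mathcal{X}^\star$ is the set of minimizers of $f$. The maximum defining $\Delta$ is read as a supremum, possibly $+\infty$ (then $V=0$). Potential: $\psi(x,x^-):=f(x)+\frac{\omega}{2}\|x-x^-\|^2$. Heavy-ball feedback: with $x^+(P,B):=x-P\nabla f(x)+B(x-x^-)$, $$h_{x,x^-}(P,B):=\frac{\psi(x^+(P,B),x)-\psi(x,x^-)}{\|\nabla f(x)\|^2+\frac{\tau}{2}\|x-x^-\|^2}.$$ HDM-HB maintains a pair $(x^k,x^k_-)$ (current point and previous point; the paper writes $x^{k-1}$ for $x^k_-$). Start with $x^1=x^1_-$, $f(x^1)>f(x^\star)$, $P_1\in\mathcal{P}$, $B_1\in\mathcal{B}$. For $k=1,2,\dots$: $$x^{k+1/2}=x^k-P_k\nabla f(x^k)+B_k(x^k-x^k_-),$$ $$P_{k+1}=\Pi_{\mathcal{P}}[P_k-\eta_p\nabla_Ph_{x^k,x^k_-}(P_k,B_k)],\qquad B_{k+1}=\Pi_{\mathcal{B}}[B_k-\eta_b\nabla_Bh_{x^k,x^k_-}(P_k,B_k)],$$ $$(x^{k+1},x^{k+1}_-)\in\operatorname{argmin}_{(u,v)\in\{(x^k,x^k_-),\,(x^{k+1/2},x^k)\}}\psi(u,v).$$ The denominators of the feedbacks for $k=1,\dots,K$ are assumed nonzero. *)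

(* Defs.v *)
From HB Require Import structures.
From mathcomp Require Export all_boot all_order all_algebra.
From mathcomp Require Export all_classical all_reals all_analysis.

Set Implicit Arguments.
Unset Strict Implicit.
Unset Printing Implicit Defensive.

Import Order.TTheory GRing.Theory Num.Theory.
Import numFieldNormedType.Exports.

Local Open Scope classical_set_scope.
Local Open Scope ring_scope.

Section Generic.
Variable R : realType.

(* Frobenius norm; on column vectors it is the Euclidean norm.  The library
   norm `|A| on matrices is the max norm and is not used here. *)
Definition fnorm (m n : nat) (A : 'M[R]_(m, n)) : R :=
  Num.sqrt (\sum_i \sum_j A i j ^+ 2).

(* Gradient for the Frobenius inner product (for column vectors, the usual
   Euclidean gradient). *)
Definition grad (m n : nat) (F : 'M[R]_(m, n) -> R) (A : 'M[R]_(m, n)) :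
    'M[R]_(m, n) :=
  \matrix_(i, j) 'D_(delta_mx i j) F A.

Definition L_smooth (n : nat) (L : R) (f : 'cV[R]_n -> R) : Prop :=
  (forall x, differentiable f x) /\
  (forall x y, fnorm (grad f x - grad f y) <= L * fnorm (x - y)).

Definition diam (m n : nat) (S : set 'M[R]_(m, n)) : \bar R :=
  ereal_sup [set (fnorm (Q.1 - Q.2))%:E | Q in S `*` S].

Definition argmin (T : Type) (S : set T) (F : T -> R) : set T :=
  [set a | S a /\ forall b, S b -> F a <= F b].

(* The value of F on argmin S F, which does not depend on the chosen point;
   0 is a dummy value for the case where the minimum is not attained. *)
Definition minval (T : Type) (S : set T) (F : T -> R) : R :=
  xget 0 (F @` argmin S F).

(* B is an orthogonal projection of A on S (unique if S is closed and
   convex). *)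
Definition is_proj (m n : nat) (S : set 'M[R]_(m, n)) (A B : 'M[R]_(m, n)) :
    Prop :=
  argmin S (fun Z => fnorm (A - Z)) B.

End Generic.

Section HeavyBall.
Variables (R : realType) (n : nat).
Implicit Types (f : 'cV[R]_n -> R) (x xm : 'cV[R]_n) (P B : 'M[R]_n).

Definition potential f (omega : R) x xm : R :=
  f x + omega / 2 * fnorm (x - xm) ^+ 2.

Definition hb_step f x xm P B : 'cV[R]_n :=
  x - P *m grad f x + B *m (x - xm).

Definition hb_denom f (tau : R) x xm : R :=
  fnorm (grad f x) ^+ 2 + tau / 2 * fnorm (x - xm) ^+ 2.

Definition hb_feedback f (omega tau : R) x xm P B : R :=
  (potential f omega (hb_step f x xm P B) x - potential f omega x xm)
    / hb_denom f tau x xm.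

(* K iterations of HDM-HB, with iterates indexed from 1; xm k is the previous
   point paired with x k. *)
Definition HDM_HB f (omega tau : R) (Pset Bset : set 'M[R]_n)
    (eta_p eta_b : R) (K : nat)
    (x xm : nat -> 'cV[R]_n) (P B : nat -> 'M[R]_n) : Prop :=
  [/\ xm 1%N = x 1%N, Pset (P 1%N), Bset (B 1%N) &
    forall k : nat, (1 <= k <= K)%N ->
      [/\ is_proj Pset
            (P k - eta_p *: grad
               (fun Q => hb_feedback f omega tau (x k) (xm k) Q (B k)) (P k))
            (P k.+1),
          is_proj Bset
            (B k - eta_b *: grad
               (fun Q => hb_feedback f omega tau (x k) (xm k) (P k) Q) (B k))
            (B k.+1) &
          argmin
            [set (x k, xm k);
                 (hb_step f (x k) (xm k) (P k) (B k), x k)]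
            (fun u => potential f omega u.1 u.2)
            (x k.+1, xm k.+1)]].

Definition gamma_star f (omega tau : R) (Pset Bset : set 'M[R]_n) (K : nat)
    (x xm : nat -> 'cV[R]_n) : R :=
  - minval (Pset `*` Bset) (fun Q =>
      K%:R^-1 *
      \sum_(1 <= k < K.+1) hb_feedback f omega tau (x k) (xm k) Q.1 Q.2).

Definition regret f (omega tau : R) (Pset Bset : set 'M[R]_n) (K : nat)
    (x xm : nat -> 'cV[R]_n) (P B : nat -> 'M[R]_n) : R :=
  \sum_(1 <= k < K.+1) hb_feedback f omega tau (x k) (xm k) (P k) (B k)
  - minval (Pset `*` Bset) (fun Q =>
      \sum_(1 <= k < K.+1) hb_feedback f omega tau (x k) (xm k) Q.1 Q.2).

(* Supremum over the sublevel set of x1 of the distance to the set of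
   minimizers of f; possibly +oo. *)
Definition Delta f (x1 : 'cV[R]_n) : \bar R :=
  ereal_sup [set (minval (argmin setT f) (fun y => fnorm (x - y)))%:E
            | x in [set x | f x <= f x1]].

(* fstar is the minimum value of f; the second branch is the case
   Delta f x1 = +oo. *)
Definition Vconst f (omega tau : R) (fstar : R) (x1 : 'cV[R]_n) : R :=
  if Delta f x1 is r%:E then
    Num.min ((f x1 - fstar) / (4 * r ^+ 2)) (tau / (4 * omega))
  else 0.

End HeavyBall.

(* Main.v *)
Require Import Defs.
From mathcomp Require Import ring lra.

Set Implicit Arguments.
Unset Strict Implicit.
Unset Printing Implicit Defensive.

Import Order.TTheory GRing.Theory Num.Theory.
Import numFieldNormedType.Exports.

Local Open Scope classical_set_scope.
Local Open Scope ring_scope.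

(** Two estimates are combined.

    Regret. For fixed [x] and [xm] the new point is affine in the two matrices,
    so the feedback is a convex function of them, and the matrix updates are
    projected online gradient descent on these convex losses
    ([feedback_linearized], [projected_gradient_regret]). The normalization by
    [hb_denom] makes the losses Lipschitz on bounded sets, uniformly in [f] and
    in the iterates ([feedback_grad_bounded]): their gradients are rank-one
    matrices whose size and the denominator are both quadratic in
    [(grad f x, x - xm)]. The standard telescoping argument ([regret_against])
    then bounds the regret against any fixed pair by
    [D ^+ 2 / eta + eta * K * G / 2], where [G] bounds the squared gradients;
    the stepsize [1 / sqrt K] balances the two terms. The minimum in the
    definition of the regret is attained because the sets are compact
    ([closed_fnorm_bounded_compact]).

    Decrease. At each iteration the potential drops by at least
    [max (- h k) 0 * hb_denom] ([potential_decrease]). The denominator dominates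
    the squared gap [a k] of the potential: it is at least [V * a k ^+ 2 / a 1]
    ([gap_sqr_le_denom]), because convexity bounds [f x - f xstar] by the
    gradient norm times the distance to the minimizers. This gives
    [a k.+1 <= a k - V * max (- h k) 0 * a k ^+ 2 / a 1], and such a recursion
    forces [a K.+1 * (1 + V * \sum_k max (- h k) 0) <= a 1]
    ([quadratic_decrease]). The sum of the [max (- h k) 0] is at least [K] times
    the positive part of the average of [- h k], and this average is
    [gammaK - rhoK / K], since the minimum of the total feedback enters
    [gammaK] and [rhoK / K] with the same sign. *)

(** * Frobenius inner product and norm *)

Section Frobenius.
Variable R : realType.

Definition inner (m n : nat) (A B : 'M[R]_(m, n)) : R := \tr (A *m B^T).

Section Inner.
Variables m n : nat.
Implicit Types A B C : 'M[R]_(m, n).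

Lemma innerE A B : inner A B = \sum_i \sum_j A i j * B i j.
Proof.
rewrite /inner /mxtrace; apply: eq_bigr => i _; rewrite mxE.
by apply: eq_bigr => j _; rewrite mxE.
Qed.

Lemma innerC A B : inner A B = inner B A.
Proof. by rewrite /inner -mxtrace_tr trmx_mul trmxK. Qed.

Lemma innerDl A B C : inner (A + B) C = inner A C + inner B C.
Proof. by rewrite /inner mulmxDl mxtraceD. Qed.

Lemma innerZl a A B : inner (a *: A) B = a * inner A B.
Proof. by rewrite /inner -scalemxAl mxtraceZ. Qed.

Lemma innerNl A B : inner (- A) B = - inner A B.
Proof. by rewrite -scaleN1r innerZl mulN1r. Qed.

Lemma innerDr A B C : inner A (B + C) = inner A B + inner A C.
Proof. by rewrite innerC innerDl !(innerC A). Qed.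

Lemma innerZr a A B : inner A (a *: B) = a * inner A B.
Proof. by rewrite innerC innerZl (innerC A). Qed.

Lemma innerNr A B : inner A (- B) = - inner A B.
Proof. by rewrite innerC innerNl (innerC A). Qed.

Lemma innerBr A B C : inner A (B - C) = inner A B - inner A C.
Proof. by rewrite innerDr innerNr. Qed.

Lemma inner_delta A i j : inner A (delta_mx i j) = A i j.
Proof.
rewrite innerE (bigD1 i)//= (bigD1 j)//= mxE !eqxx mulr1.
rewrite big1 => [|k kj]; last by rewrite mxE eqxx (negbTE kj) mulr0.
rewrite addr0 big1 ?addr0// => k ki; apply: big1 => l _.
by rewrite mxE (negbTE ki) mulr0.
Qed.

Lemma fnorm_ge0 A : 0 <= fnorm A.
Proof. exact: sqrtr_ge0. Qed.

Lemma fnorm_sqr A : fnorm A ^+ 2 = inner A A.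
Proof.
rewrite innerE sqr_sqrtr//; apply: sumr_ge0 => i _; apply: sumr_ge0 => j _.
exact: sqr_ge0.
Qed.

Lemma ler_fnorm_coord A i j : `|A i j| <= fnorm A.
Proof.
rewrite -(@ler_pXn2r _ 2) ?nnegrE ?normr_ge0 ?fnorm_ge0//.
rewrite real_normK ?num_real// fnorm_sqr innerE (bigD1 i)//= (bigD1 j)//=.
rewrite -expr2 -addrA lerDl.
apply: addr_ge0; first by apply: sumr_ge0 => k _; rewrite -expr2 sqr_ge0.
by apply: sumr_ge0 => k _; apply: sumr_ge0 => l _; rewrite -expr2 sqr_ge0.
Qed.

Lemma fnorm_eq0 A : fnorm A = 0 -> A = 0.
Proof.
move=> A0; apply/matrixP => i j; rewrite mxE; apply/eqP.
by rewrite -normr_le0 -A0 ler_fnorm_coord.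
Qed.

Lemma fnormN A : fnorm (- A) = fnorm A.
Proof.
apply/eqP; rewrite -(@eqrXn2 _ 2) ?fnorm_ge0//.
by rewrite !fnorm_sqr innerNl innerNr opprK.
Qed.

Lemma fnormBC A B : fnorm (A - B) = fnorm (B - A).
Proof. by rewrite -fnormN opprB. Qed.

Lemma fnormD_sqr A B :
  fnorm (A + B) ^+ 2 = fnorm A ^+ 2 + 2 * inner A B + fnorm B ^+ 2.
Proof. by rewrite !fnorm_sqr innerDl !innerDr (innerC B A); ring. Qed.

Lemma fnormB_sqr A B :
  fnorm (A - B) ^+ 2 = fnorm A ^+ 2 - 2 * inner A B + fnorm B ^+ 2.
Proof. by rewrite fnormD_sqr fnormN innerNr mulrN. Qed.

Lemma fnormZ_sqr a A : fnorm (a *: A) ^+ 2 = a ^+ 2 * fnorm A ^+ 2.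
Proof. by rewrite !fnorm_sqr innerZl innerZr; ring. Qed.

Lemma Cauchy_Schwarz A B : inner A B <= fnorm A * fnorm B.
Proof.
have inner0l M : inner 0 M = 0 :> R by rewrite /inner mul0mx mxtrace0.
have [/fnorm_eq0 ->|A0] := eqVneq (fnorm A) 0.
  by rewrite inner0l mulr_ge0// fnorm_ge0.
have [/fnorm_eq0 ->|B0] := eqVneq (fnorm B) 0.
  by rewrite innerC inner0l mulr_ge0// fnorm_ge0.
have AB0 : 0 < fnorm A * fnorm B by rewrite mulr_gt0// lt_def ?A0 ?B0 fnorm_ge0.
(* Expand the square of the vector that vanishes in the equality case. *)
have := sqr_ge0 (fnorm (fnorm B *: A - fnorm A *: B)).
rewrite fnormB_sqr !fnormZ_sqr innerZl innerZr => h.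
rewrite -(ler_pM2l AB0); nra.
Qed.

Lemma fnormZ a A : fnorm (a *: A) = `|a| * fnorm A.
Proof.
apply/eqP; rewrite -(@eqrXn2 _ 2) ?mulr_ge0 ?fnorm_ge0// fnormZ_sqr exprMn.
by rewrite real_normK ?num_real.
Qed.

Lemma fnorm0 : fnorm (0 : 'M[R]_(m, n)) = 0.
Proof. by rewrite -(scale0r 0) fnormZ normr0 mul0r. Qed.

Lemma ler_fnormD A B : fnorm (A + B) <= fnorm A + fnorm B.
Proof.
rewrite -(@ler_pXn2r _ 2) ?nnegrE ?addr_ge0 ?fnorm_ge0//.
by rewrite fnormD_sqr sqrrD mulr2n; have := Cauchy_Schwarz A B; lra.
Qed.

End Inner.

(** This identity turns a directional derivative along [Q *m g] into the matrix
    gradient [w *m g^T]. *)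
Lemma inner_outer (m n : nat) (w : 'cV[R]_m) (g : 'cV[R]_n) (Q : 'M[R]_(m, n)) :
  inner (w *m g^T) Q = inner w (Q *m g).
Proof. by rewrite /inner trmx_mul mulmxA. Qed.

Lemma fnorm_outer (m n : nat) (w : 'cV[R]_m) (g : 'cV[R]_n) :
  fnorm (w *m g^T) = fnorm w * fnorm g.
Proof.
apply/eqP; rewrite -(@eqrXn2 _ 2) ?mulr_ge0 ?fnorm_ge0//; apply/eqP.
rewrite exprMn !fnorm_sqr inner_outer -mulmxA.
have -> : g^T *m g = (inner g g)%:M.
  rewrite /inner mxtrace_mulC [LHS]mx11_scalar {2}[g^T *m g]mx11_scalar.
  by rewrite mxtrace_scalar mulr1n.
by rewrite mul_mx_scalar innerZr mulrC.
Qed.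

(** The square [fnorm (Q *m g) ^+ 2] is the inner product of [Q] with the
    rank-one matrix [(Q *m g) *m g^T], so Cauchy-Schwarz applies to matrices. *)
Lemma fnorm_mulmx (m n : nat) (Q : 'M[R]_(m, n)) (g : 'cV[R]_n) :
  fnorm (Q *m g) <= fnorm Q * fnorm g.
Proof.
have [->|Qg0] := eqVneq (fnorm (Q *m g)) 0.
  by rewrite mulr_ge0 ?fnorm_ge0.
have : 0 < fnorm (Q *m g) by rewrite lt_def Qg0 fnorm_ge0.
move/ler_pM2l => <-; rewrite -expr2 fnorm_sqr -inner_outer.
apply: le_trans (Cauchy_Schwarz _ _) _.
by rewrite fnorm_outer -mulrA (mulrC (fnorm g)).
Qed.

End Frobenius.

(** * First-order calculus of the feedback *)

Section Calculus.
Variable R : realType.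

Section DirectionalDerivatives.
Variables m n : nat.
Implicit Types (f : 'M[R]_(m, n) -> R) (x y u v : 'M[R]_(m, n)).

Lemma derive_grad f x v : differentiable f x -> 'D_v f x = inner (grad f x) v.
Proof.
move=> fx; rewrite deriveE// {1}(matrix_sum_delta v) linear_sum innerE.
apply: eq_bigr => i _; rewrite linear_sum; apply: eq_bigr => j _.
by rewrite linearZ mxE deriveE//= mulrC.
Qed.

(** The slopes of [f] along the segment from [x] to [y] are at most
    [f y - f x], and they tend to the directional derivative. *)
Lemma convex_above_tangent f x y :
  convex_function setT f -> differentiable f x ->
  f x + inner (grad f x) (y - x) <= f y.
Proof.
move=> cf fx; rewrite -derive_grad//; set v := y - x.
rewrite addrC -lerBrDr /derive.
have dfx : derivable f x v by exact: diff_derivable.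
rewrite (cvg_at_rightE _ _ dfx); apply: limr_le.
  exact: cvgP (cvg_dnbhs_at_right dfx).
near=> h.
have h0 : 0 < h by near: h; exact: nbhs_right_gt.
have h1 : h <= 1 by near: h; apply: nbhs_right_le.
have := cf (Itv01 (ltW h0) h1) y x (in_setT _) (in_setT _).
rewrite convRE /= /conv/= => cfh.
rewrite /GRing.scale/= ler_pdivrMl//.
have -> : h *: v + x = h *: y + (1 - h) *: x.
  by rewrite /v scalerBr scalerBl scale1r -addrA (addrC x).
move: cfh; rewrite /unstable.onem/= => cfh; lra.
Unshelve. all: by end_near. Qed.

(** The difference quotient is affine in the increment, so its limit is read
    off directly. *)
Lemma derive_fnorm_sqr x y u :
  is_derive x u (fun z => fnorm (z - y) ^+ 2) (2 * inner (x - y) u).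
Proof.
suff lim_q : (fun h : R => h^-1 *:
      (((fun z => fnorm (z - y) ^+ 2) \o shift x) (h *: u) - fnorm (x - y) ^+ 2))
    @ 0^' --> 2 * inner (x - y) u.
  by apply: DeriveDef; [exact: cvgP lim_q | exact: cvg_lim lim_q].
have : (fun h : R => 2 * inner (x - y) u + h * fnorm u ^+ 2) @ 0^'
    --> 2 * inner (x - y) u + 0 * fnorm u ^+ 2.
  apply: cvgD; first exact: cvg_cst.
  by apply: cvgMl; apply: nbhs_dnbhs.
rewrite mul0r addr0; apply: cvg_trans; apply: near_eq_cvg; near=> h.
have h0 : h != 0 by near: h; exact: nbhs_dnbhs_neq.
rewrite /=.
have -> : h *: u + x - y = (x - y) + h *: u by rewrite -addrA addrC.
rewrite fnormD_sqr fnormZ_sqr innerZr /GRing.scale/=.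
by field.
Unshelve. all: by end_near. Qed.

End DirectionalDerivatives.

(** An affine [phi] maps the line through [a] to the line through [phi a], and
    the two difference quotients coincide. In this way the derivative of a
    feedback with respect to a matrix reduces to one in the space of points. *)
Lemma derive_comp_affine (V W : normedModType R) (F : W -> R) (phi : V -> W)
    (a v : V) (u : W) :
  (forall h : R, phi (h *: v + a) = h *: u + phi a) ->
  'D_v (F \o phi) a = 'D_u F (phi a).
Proof.
move=> phiE; rewrite /derive; under eq_fun do rewrite /= phiE.
by [].
Qed.

End Calculus.

Section Feedback.
Variables (R : realType) (n : nat) (f : 'cV[R]_n -> R) (omega tau : R).
Hypothesis df : forall x, differentiable f x.
Implicit Types (x xm z u : 'cV[R]_n) (P B Q : 'M[R]_n).

(** Gradient at [z] of [potential f omega ^~ x]. *)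
Definition potential_grad z x : 'cV[R]_n := grad f z + omega *: (z - x).

Lemma derive_potential z x u :
  is_derive z u (fun y => potential f omega y x) (inner (potential_grad z x) u).
Proof.
have fz : is_derive z u f (inner (grad f z) u).
  have fz := df z.
  by apply: DeriveDef; [exact: diff_derivable | exact: derive_grad].
have qz := derive_fnorm_sqr z x u.
have -> : (fun y => potential f omega y x) =
   f + omega / 2 \*: (fun y => fnorm (y - x) ^+ 2) by [].
apply: is_derive_eq; rewrite /potential_grad (innerDl (grad f z)) innerZl.
by rewrite /GRing.scale/=; congr (_ + _); field.
Qed.

Lemma potential_above_tangent z y x :
  convex_function setT f -> 0 <= omega ->
  potential f omega z x + inner (potential_grad z x) (y - z)
  <= potential f omega y x.
Proof.
move=> cf omega0.
rewrite /potential /potential_grad (innerDl (grad f z)) innerZl.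
have := convex_above_tangent y cf (df z).
have -> : y - x = (z - x) + (y - z) by rewrite [RHS]addrC subrKA.
rewrite (fnormD_sqr (z - x)).
have := mulr_ge0 omega0 (sqr_ge0 (fnorm (y - z))).
lra.
Qed.

Lemma hb_step_shift_P x xm P Q B :
  hb_step f x xm (Q + P) B = - (Q *m grad f x) + hb_step f x xm P B.
Proof. by rewrite /hb_step mulmxDl opprD addrCA !addrA. Qed.

Lemma hb_step_shift_B x xm P Q B :
  hb_step f x xm P (Q + B) = Q *m (x - xm) + hb_step f x xm P B.
Proof. by rewrite /hb_step mulmxDl addrCA. Qed.

Let feedback_at x xm : 'cV[R]_n -> R :=
  fun z =>
    (potential f omega z x - potential f omega x xm) / hb_denom f tau x xm.

Let derive_feedback_at x xm z u :
  'D_u (feedback_at x xm) z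
  = (hb_denom f tau x xm)^-1 * inner (potential_grad z x) u.
Proof.
have pz := derive_potential z x u.
have -> : feedback_at x xm = (hb_denom f tau x xm)^-1 \*:
    ((fun y => potential f omega y x) - cst (potential f omega x xm)).
  by apply/funext => y; rewrite /feedback_at mulrC.
by apply: derive_val; apply: is_derive_eq; rewrite subr0.
Qed.

Lemma grad_feedback_P x xm P B :
  grad (fun Q => hb_feedback f omega tau x xm Q B) P
  = - ((hb_denom f tau x xm)^-1 *:
       (potential_grad (hb_step f x xm P B) x *m (grad f x)^T)).
Proof.
apply/matrixP => i j; rewrite mxE.
rewrite [LHS](@derive_comp_affine R _ _ (feedback_at x xm)
   (fun Q => hb_step f x xm Q B) P _ (- (delta_mx i j *m grad f x))) => [|h];
  last by rewrite hb_step_shift_P -scalemxAl scalerN.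
rewrite derive_feedback_at innerNr -inner_outer inner_delta.
by move: (_ *m (grad f x)^T) => N; rewrite !mxE mulrN.
Qed.

Lemma grad_feedback_B x xm P B :
  grad (fun Q => hb_feedback f omega tau x xm P Q) B
  = (hb_denom f tau x xm)^-1 *:
      (potential_grad (hb_step f x xm P B) x *m (x - xm)^T).
Proof.
apply/matrixP => i j; rewrite mxE.
rewrite [LHS](@derive_comp_affine R _ _ (feedback_at x xm)
   (fun Q => hb_step f x xm P Q) B _ (delta_mx i j *m (x - xm))) => [|h];
  last by rewrite hb_step_shift_B -scalemxAl.
rewrite derive_feedback_at -inner_outer inner_delta.
by move: (_ *m (x - xm)^T) => N; rewrite mxE.
Qed.

(** Joint convexity of the feedback in the two matrices: [hb_step] is affine in
    them, and the potential is convex. *)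
Lemma feedback_linearized x xm P B P' B' :
  convex_function setT f -> 0 <= omega -> 0 < hb_denom f tau x xm ->
  hb_feedback f omega tau x xm P B - hb_feedback f omega tau x xm P' B'
  <= inner (grad (fun Q => hb_feedback f omega tau x xm Q B) P) (P - P')
     + inner (grad (fun Q => hb_feedback f omega tau x xm P Q) B) (B - B').
Proof.
move=> cf omega0 den0; rewrite grad_feedback_P grad_feedback_B.
rewrite innerNl !innerZl !inner_outer /hb_feedback.
have := potential_above_tangent
  (hb_step f x xm P B) (hb_step f x xm P' B') x cf omega0.
have -> : hb_step f x xm P' B' - hb_step f x xm P B
    = (P - P') *m grad f x - (B - B') *m (x - xm).
  rewrite -{1}(subrK P' P) -{1}(subrK B' B) hb_step_shift_P hb_step_shift_B.
  move: (hb_step _ _ _ _ _) (_ *m _) (_ *m _) => u v w.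
  by apply/matrixP => i j; rewrite !mxE; ring.
rewrite innerBr.
have /ler_pM2l <- : 0 < (hb_denom f tau x xm)^-1 by rewrite invr_gt0.
lra.
Qed.

End Feedback.

(** * Compactness and attained minima *)

Section Compactness.
Variable R : realType.

Lemma continuous_mx (T : topologicalType) (m n : nat) (F : T -> 'M[R]_(m, n)) :
  (forall i j, continuous (fun t => F t i j)) -> continuous F.
Proof.
move=> cF t; apply/cvgrPdist_lt => e e0.
have h i j : \forall s \near t, `|F t i j - F s i j| < e.
  by move: e e0; apply/cvgrPdist_lt; exact: cF.
have : \forall s \near t, forall ij : 'I_m * 'I_n,
    `|F t ij.1 ij.2 - F s ij.1 ij.2| < e.
  by apply: filter_forall => -[i j]; exact: h.
apply: filterS => s hs.
rewrite [X in X < _]/Num.norm/= mx_normrE; apply/bigmax_ltP; split => // ij _.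
by rewrite !mxE.
Qed.

Lemma continuous_sumr (T : topologicalType) (I : Type) (r : seq I)
    (F : I -> T -> R) :
  (forall i, continuous (F i)) -> continuous (fun t => \sum_(i <- r) F i t).
Proof. by move=> cF; apply: continuous_big => //; exact: add_continuous. Qed.

Lemma continuous_fnorm_sqr (m n : nat) :
  continuous (fun A : 'M[R]_(m, n) => fnorm A ^+ 2).
Proof.
have -> : (fun A : 'M[R]_(m, n) => fnorm A ^+ 2) =
   (fun A => \sum_i \sum_j A i j * A i j).
  by apply/funext => A; rewrite fnorm_sqr innerE.
apply: continuous_sumr => i; apply: continuous_sumr => j A.
by apply: cvgM; [exact: (nbhs_filter A)|exact: coord_continuous..].
Qed.

Lemma continuous_fnorm (m n : nat) : continuous (@fnorm R m n).
Proof.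
have -> : @fnorm R m n = (fun A => Num.sqrt (fnorm A ^+ 2)).
  by apply/funext => A; rewrite sqrtr_sqr ger0_norm// fnorm_ge0.
move=> A; apply: continuous_comp; first exact: continuous_fnorm_sqr.
exact: sqrt_continuous.
Qed.

(** Matrices are reshaped into row vectors, for which closed bounded sets are
    compact. *)
Lemma closed_fnorm_bounded_compact (m n : nat) (S : set 'M[R]_(m, n)) (M : R) :
  closed S -> (forall A, S A -> fnorm A <= M) -> compact S.
Proof.
move=> cS bS.
have cvec : continuous (@vec_mx R m n).
  apply: continuous_mx => i j.
  rewrite (_ : (fun _ => _) = (fun v : 'rV_(m * n) => v 0 (mxvec_index i j))).
    exact: coord_continuous.
  by apply/funext => v; rewrite mxE.
have -> : S = vec_mx @` (vec_mx @^-1` S).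
  apply/seteqP; split => [A SA|_ [v Sv <-]//].
  by exists (mxvec A); rewrite /= mxvecK.
apply: continuous_compact; first exact/continuous_subspaceT.
apply: bounded_closed_compact; last exact: (continuous_closedP _).1.
exists M; split; first exact: num_real.
move=> M' MM' v Sv; rewrite /Num.norm/= mx_normrE; apply/bigmax_leP; split.
  by rewrite (le_trans (fnorm_ge0 _) (le_trans (bS _ Sv) _))// ltW.
move=> [i k] _ /=; rewrite ord1.
case/mxvec_indexP: k => a b.
have -> : v 0 (mxvec_index a b) = vec_mx v a b by rewrite mxE.
exact: le_trans (ler_fnorm_coord _ _ _) (le_trans (bS _ Sv) (ltW MM')).
Qed.

Lemma minvalE (T : Type) (S : set T) (F : T -> R) (a : T) :
  argmin S F a -> minval S F = F a.
Proof.
move=> [Sa mina]; rewrite /minval.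
case: xgetP => [r _ [b [Sb minb] <-]|/(_ (F a))].
  by apply/eqP; rewrite eq_le minb//= mina.
by case; exists a.
Qed.

Lemma argmin_scale (T : Type) (S : set T) (F : T -> R) (c : R) (a : T) :
  0 <= c -> argmin S F a -> argmin S (fun t => c * F t) a.
Proof. by move=> c0 [Sa mina]; split => // b Sb; rewrite ler_wpM2l// mina. Qed.

Lemma compact_argmin (T : topologicalType) (S : set T) (F : T -> R) :
  S !=set0 -> compact S -> continuous F -> exists a, argmin S F a.
Proof.
move=> S0 cS cF.
have [a Sa mina] := compact_EVT_min S0 cS (continuous_subspaceT cF).
by exists a; split; [exact: set_mem | move=> b Sb; apply: mina; exact: mem_set].
Qed.

(** The ball centred at [x] and reaching some point of [S] cuts [S] down to a
    compact set without losing the closest points. *)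
Lemma nearest_point (m n : nat) (S : set 'M[R]_(m, n)) (x : 'M[R]_(m, n)) :
  closed S -> S !=set0 -> exists y, argmin S (fun y => fnorm (x - y)) y.
Proof.
move=> cS [s0 Ss0]; set F := fun y => fnorm (x - y).
have cF : continuous F.
  move=> y; have cxB : {for y, continuous (fun y : 'M[R]_(m, n) => x - y)}.
    by apply: continuousB; [exact: cst_continuous | exact: cvg_id].
  exact: (continuous_comp cxB (@continuous_fnorm _ _ _)).
pose T := S `&` [set y | F y <= F s0].
have cT : compact T.
  apply: (@closed_fnorm_bounded_compact _ _ _ (fnorm x + F s0)).
    apply: closedI => //.
    exact: ((continuous_closedP _).1 cF _ (@closed_le _ (F s0))).
  move=> A [_ AF]; have -> : A = x - (x - A) by rewrite opprB addrC subrK.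
  by apply: le_trans (ler_fnormD _ _) _; rewrite fnormN lerD2l.
have T0 : T !=set0 by exists s0; split => //=.
have [y [[Sy Fy] miny]] := compact_argmin T0 cT cF.
exists y; split => // z Sz; have [Fz|/ltW Fz] := leP (F z) (F s0).
  exact: miny.
exact: le_trans Fy Fz.
Qed.

Lemma closed_argmin (T : topologicalType) (F : T -> R) (a : T) :
  continuous F -> argmin setT F a -> closed (argmin setT F).
Proof.
move=> cF [_ mina].
have -> : argmin setT F = F @^-1` [set r | r <= F a].
  apply/seteqP; split => [b [_ minb]|b Fba]; first exact: minb.
  by split => // c _; exact: le_trans Fba (mina _ _).
exact: ((continuous_closedP _).1 cF _ (@closed_le _ (F a))).
Qed.

Lemma diamP (m n : nat) (S : set 'M[R]_(m, n)) (D : R) :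
  (diam S <= D%:E)%E -> forall A B, S A -> S B -> fnorm (A - B) <= D.
Proof.
move=> dS A B SA SB; rewrite -lee_fin; apply: le_trans dS.
by apply: ereal_sup_ubound; exists (A, B).
Qed.

End Compactness.

(** * Projected gradient steps and bounded feedback gradients *)

Section Projection.
Variables (R : realType) (m n : nat).
Implicit Types A B G Z : 'M[R]_(m, n).

(** Moving from the projection [B] towards [Z] stays in [S], hence cannot bring
    one closer to [A]; the first-order term of the squared distance along this
    segment has the stated sign. *)
Lemma proj_obtuse (S : set 'M[R]_(m, n)) A B Z :
  convex_set S -> is_proj S A B -> S Z -> inner (A - B) (Z - B) <= 0.
Proof.
move=> cS [SB minB] SZ; set ip := inner _ _; set q := fnorm (Z - B) ^+ 2.
have segment t : 0 < t -> t <= 1 -> 2 * ip <= t * q.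
  move=> t0 t1; have St : S (t *: Z + (1 - t) *: B).
    exact: set_mem (cS Z B (Itv01 (ltW t0) t1) (mem_set SZ) (mem_set SB)).
  have := minB _ St; rewrite -(@ler_pXn2r _ 2) ?nnegrE ?fnorm_ge0//.
  have -> : A - (t *: Z + (1 - t) *: B) = (A - B) - t *: (Z - B).
    by apply/matrixP => i j; rewrite !mxE; ring.
  rewrite (fnormB_sqr (A - B)) fnormZ_sqr innerZr -/ip -/q => h.
  by rewrite -(ler_pM2l t0); lra.
rewrite leNgt; apply/negP => ip0.
have q0 : 0 <= q by exact: sqr_ge0.
(* A step short enough for the first-order term to dominate. *)
have := segment (ip / (ip + q)); rewrite divr_gt0 ?ltr_wpDr// => /(_ isT).
rewrite ler_pdivrMr ?mul1r ?lerDl ?ltr_wpDr// => /(_ q0).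
rewrite mulrAC ler_pdivlMr ?ltr_wpDr//; nra.
Qed.

(** The angle at the projection is obtuse, so [A] is farther from [Z] than its
    projection. *)
Lemma proj_closer (S : set 'M[R]_(m, n)) A B Z :
  convex_set S -> is_proj S A B -> S Z ->
  fnorm (B - Z) ^+ 2 <= fnorm (A - Z) ^+ 2.
Proof.
move=> cS pB SZ; have := proj_obtuse cS pB SZ.
have -> : A - Z = (A - B) - (Z - B) by rewrite opprB subrKA.
rewrite (fnormB_sqr (A - B)) (fnormBC Z).
by have := sqr_ge0 (fnorm (A - B)); lra.
Qed.

Lemma projected_gradient_step (S : set 'M[R]_(m, n)) (eta : R) A G B Z :
  convex_set S -> is_proj S (A - eta *: G) B -> S Z ->
  2 * eta * inner G (A - Z)
  <= fnorm (A - Z) ^+ 2 - fnorm (B - Z) ^+ 2 + eta ^+ 2 * fnorm G ^+ 2.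
Proof.
move=> cS pB SZ; have := proj_closer cS pB SZ.
rewrite addrAC (fnormB_sqr (A - Z)) fnormZ_sqr innerZr (innerC (A - Z)).
lra.
Qed.

(** One step of online gradient descent with a common stepsize on two blocks:
    [r] is a loss gap bounded by its linearization. The squared distances to
    the comparator [(Z, W)] telescope along a run. *)
Lemma projected_gradient_regret (S T : set 'M[R]_(m, n)) (eta c r : R)
    A A' G Z B B' H W :
  0 <= eta -> convex_set S -> convex_set T ->
  is_proj S (A - eta *: G) A' -> S Z -> is_proj T (B - eta *: H) B' -> T W ->
  r <= inner G (A - Z) + inner H (B - W) ->
  fnorm G ^+ 2 + fnorm H ^+ 2 <= c ->
  2 * eta * r <= fnorm (A - Z) ^+ 2 + fnorm (B - W) ^+ 2
                 - (fnorm (A' - Z) ^+ 2 + fnorm (B' - W) ^+ 2) + eta ^+ 2 * c.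
Proof.
move=> eta0 cS cT pA SZ pB TW lin bound.
have := projected_gradient_step cS pA SZ.
have := projected_gradient_step cT pB TW.
have := ler_wpM2l (mulr_ge0 (ler0n R 2) eta0) lin.
have := ler_wpM2l (sqr_ge0 eta) bound.
lra.
Qed.

End Projection.

Section FeedbackBounds.
Variables (R : realType) (n : nat) (f : 'cV[R]_n -> R) (L omega tau : R).
Hypotheses (L_gt0 : 0 < L) (omega_gt0 : 0 < omega) (tau_gt0 : 0 < tau).
Hypothesis smooth : L_smooth L f.
Implicit Types (x xm : 'cV[R]_n) (P B : 'M[R]_n).

Lemma continuous_feedback x xm :
  continuous (fun Q : 'M[R]_n * 'M[R]_n =>
    hb_feedback f omega tau x xm Q.1 Q.2).
Proof.
have cstep : continuous (fun Q : 'M[R]_n * 'M[R]_n => hb_step f x xm Q.1 Q.2).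
  apply: continuous_mx => i j.
  have -> : (fun Q : 'M[R]_n * 'M[R]_n => hb_step f x xm Q.1 Q.2 i j) =
     (fun Q => x i j - \sum_k Q.1 i k * grad f x k j
               + \sum_k Q.2 i k * (x - xm) k j).
    by apply/funext => Q; rewrite /hb_step !mxE.
  have c1 k : continuous (fun Q : 'M[R]_n * 'M[R]_n => Q.1 i k * grad f x k j).
    move=> Q; apply: continuousM; last exact: cst_continuous.
    apply: (@continuous_comp _ _ _ fst (fun M : 'M[R]_n => M i k)).
      exact: cvg_fst.
    exact: coord_continuous.
  have c2 k : continuous (fun Q : 'M[R]_n * 'M[R]_n => Q.2 i k * (x - xm) k j).
    move=> Q; apply: continuousM; last exact: cst_continuous.
    apply: (@continuous_comp _ _ _ snd (fun M : 'M[R]_n => M i k)).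
      exact: cvg_snd.
    exact: coord_continuous.
  have s1 := continuous_sumr c1 (r := index_enum 'I_n).
  have s2 := continuous_sumr c2 (r := index_enum 'I_n).
  move=> Q.
  exact: (continuousD (continuousB (@cst_continuous _ _ (x i j) Q) (s1 Q))
                      (s2 Q)).
have cpot : continuous (fun z => potential f omega z x).
  move=> z; have cB : {for z, continuous (fun z : 'cV[R]_n => z - x)}.
    by apply: continuousB; [exact: cvg_id | exact: cst_continuous].
  have cq := continuous_comp cB (@continuous_fnorm_sqr _ _ _ _).
  exact: (continuousD (differentiable_continuous (smooth.1 z))
           (continuousM (@cst_continuous _ _ (omega / 2) z) cq)).
move=> Q; have cpQ := continuous_comp (cstep Q) (cpot _).
exact: (continuousM
         (continuousB cpQ (@cst_continuous _ _ (potential f omega x xm) Q))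
         (@cst_continuous _ _ (hb_denom f tau x xm)^-1 Q)).
Qed.

(** [p] and [b] bound the norms of the two matrices. The numerator comes from
    [potential_grad] at the new point, whose norm is at most
    [(1 + (L + omega) * p) * fnorm (grad f x) + (L + omega) * b * fnorm (x - xm)];
    the minimum compares [hb_denom] with the sum of the two squared norms. *)
Definition feedback_grad_bound (p b : R) : R :=
  ((1 + (L + omega) * p) ^+ 2 + ((L + omega) * b) ^+ 2)
    / Num.min 1 (tau / 2) ^+ 2.

(** Write [w] for [potential_grad] at the new point. The two gradients are rank
    one, of norms [fnorm w * fnorm (grad f x)] and [fnorm w * fnorm (x - xm)]
    divided by [hb_denom], and smoothness makes [fnorm w] of first order in the
    pair [(grad f x, x - xm)]. Numerator and denominator are thus both quadratic
    in that pair, which is why the bound depends neither on [f] nor on the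
    iterate. *)
Lemma feedback_grad_bounded (p b : R) x xm P B :
  fnorm P <= p -> fnorm B <= b -> 0 < hb_denom f tau x xm ->
  fnorm (grad (fun Q => hb_feedback f omega tau x xm Q B) P) ^+ 2
  + fnorm (grad (fun Q => hb_feedback f omega tau x xm P Q) B) ^+ 2
  <= feedback_grad_bound p b.
Proof.
move=> Pp Bb den0; rewrite grad_feedback_P; last exact: smooth.1.
rewrite grad_feedback_B; last exact: smooth.1.
rewrite fnormN !fnormZ_sqr !fnorm_outer /feedback_grad_bound.
set w := potential_grad _ _ _ _; set mu := Num.min _ _.
set g := fnorm (grad f x); set d := fnorm (x - xm).
have g0 : 0 <= g by exact: fnorm_ge0.
have d0 : 0 <= d by exact: fnorm_ge0.
have mu0 : 0 < mu by rewrite lt_min ltr01 divr_gt0.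
have denE : mu * (g ^+ 2 + d ^+ 2) <= hb_denom f tau x xm.
  rewrite mulrDr lerD//; last by rewrite ler_wpM2r ?sqr_ge0// ge_min lexx orbT.
  by rewrite -[leRHS]mul1r ler_wpM2r ?sqr_ge0// ge_min lexx.
have step_le : fnorm (hb_step f x xm P B - x) <= p * g + b * d.
  have -> : hb_step f x xm P B - x = B *m (x - xm) - P *m grad f x.
    rewrite /hb_step; move: (B *m _) (P *m _) => Bd Pg.
    by apply/matrixP => i j; rewrite !mxE; ring.
  apply: le_trans (ler_fnormD _ _) _; rewrite fnormN addrC lerD//.
    by apply: le_trans (fnorm_mulmx _ _) _; rewrite ler_wpM2r.
  by apply: le_trans (fnorm_mulmx _ _) _; rewrite ler_wpM2r.
have Lo0 : 0 < L + omega by exact: addr_gt0.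
have w_le : fnorm w <= (1 + (L + omega) * p) * g + (L + omega) * b * d.
  apply: le_trans (ler_fnormD _ _) _; rewrite fnormZ gtr0_norm//.
  have := smooth.2 (hb_step f x xm P B) x.
  have := ler_fnormD (grad f (hb_step f x xm P B) - grad f x) (grad f x).
  rewrite subrK -/g.
  have := ler_wpM2l (ltW Lo0) step_le; lra.
have w_sqr : fnorm w ^+ 2 <=
    ((1 + (L + omega) * p) ^+ 2 + ((L + omega) * b) ^+ 2) * (g ^+ 2 + d ^+ 2).
  have w2 : fnorm w ^+ 2 <=
      ((1 + (L + omega) * p) * g + (L + omega) * b * d) ^+ 2.
    rewrite ler_pXn2r ?nnegrE ?fnorm_ge0//.
    exact: le_trans (fnorm_ge0 w) w_le.
  apply: le_trans w2 _.
  move: (1 + _) ((L + omega) * b) => al be.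
  by have := sqr_ge0 (al * d - be * g); nra.
rewrite ler_pdivlMr ?exprn_gt0//.
set c := _ + ((L + omega) * b) ^+ 2 in w_sqr *.
have c0 : 0 <= c by rewrite addr_ge0 ?sqr_ge0.
have den2 : (mu * (g ^+ 2 + d ^+ 2)) ^+ 2 <= hb_denom f tau x xm ^+ 2.
  rewrite ler_pXn2r ?nnegrE// ?(ltW den0)// mulr_ge0 ?(ltW mu0)//.
  by rewrite addr_ge0 ?sqr_ge0.
have q0 : 0 <= g ^+ 2 + d ^+ 2 by rewrite addr_ge0 ?sqr_ge0.
set q := g ^+ 2 + d ^+ 2 in w_sqr den2 q0.
have -> : (hb_denom f tau x xm)^-1 ^+ 2 * (fnorm w * g) ^+ 2
    + (hb_denom f tau x xm)^-1 ^+ 2 * (fnorm w * d) ^+ 2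
    = fnorm w ^+ 2 * q / hb_denom f tau x xm ^+ 2.
  by rewrite /q; field; rewrite gt_eqF.
rewrite mulrAC ler_pdivrMr ?exprn_gt0//.
apply: le_trans (_ : c * q * q * mu ^+ 2 <= _).
  by rewrite ler_wpM2r ?sqr_ge0// ler_wpM2r.
have := ler_wpM2l c0 den2; lra.
Qed.

End FeedbackBounds.

(** * Regret *)

Section Run.
Variables (R : realType) (n : nat) (f : 'cV[R]_n -> R) (L D omega tau : R).
Hypotheses (L_gt0 : 0 < L) (omega_gt0 : 0 < omega) (tau_gt0 : 0 < tau).
Hypothesis smooth : L_smooth L f.
Hypothesis cvx : convex_function setT f.

Lemma hb_denom_ge0 x xm : 0 <= hb_denom f tau x xm.
Proof. by rewrite addr_ge0 ?sqr_ge0// mulr_ge0 ?sqr_ge0// divr_ge0// ltW. Qed.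

Section Regret.
Variables Pset Bset : set 'M[R]_n.
Hypotheses (cvxP : convex_set Pset) (cvxB : convex_set Bset).
Hypotheses (Pset0 : Pset 0) (BsetI : Bset (2^-1)%:M).
Hypotheses (diamPset : (diam Pset <= D%:E)%E).
Hypotheses (diamBset : (diam Bset <= D%:E)%E).
Variables (eta : R) (K : nat) (x xm : nat -> 'cV[R]_n) (P B : nat -> 'M[R]_n).
Hypothesis eta_gt0 : 0 < eta.
Hypothesis run : HDM_HB f omega tau Pset Bset eta eta K x xm P B.
Hypothesis den_neq0 : forall k : nat, (1 <= k <= K)%N ->
  hb_denom f tau (x k) (xm k) != 0.

Let h k := hb_feedback f omega tau (x k) (xm k).

Lemma iterates_in_sets k : (1 <= k <= K)%N -> Pset (P k) /\ Bset (B k).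
Proof.
case: run => _ P1 B1 steps; case: k => // -[|k] /andP[_ kK] //.
by have [|[SP _] [SB _] _] := steps k.+1; first exact: ltnW.
Qed.

Let G2 := feedback_grad_bound L omega tau D (D + fnorm ((2^-1)%:M : 'M[R]_n)).

(** The usual bound for online gradient descent: the one-step inequalities
    telescope, and the initial distance to a comparator is at most the
    diameter of each set. *)
Lemma regret_against P' B' : Pset P' -> Bset B' ->
  2 * eta * (\sum_(1 <= k < K.+1) h k (P k) (B k)
             - \sum_(1 <= k < K.+1) h k P' B')
  <= 2 * D ^+ 2 + K%:R * (eta ^+ 2 * G2).
Proof.
move=> SP' SB'; have D0 : 0 <= D.
  by apply: le_trans (fnorm_ge0 _) (diamP diamPset SP' SP').
pose Phi k := fnorm (P k - P') ^+ 2 + fnorm (B k - B') ^+ 2.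
have step k : (1 <= k < K.+1)%N ->
    2 * eta * (h k (P k) (B k) - h k P' B')
    <= - (Phi k.+1 - Phi k) + eta ^+ 2 * G2.
  rewrite ltnS => kK; have [SP SB] := iterates_in_sets kK.
  have [_ _ _ /(_ k kK) [pP pB _]] := run.
  have den0 : 0 < hb_denom f tau (x k) (xm k).
    by rewrite lt_def den_neq0 ?hb_denom_ge0.
  have Pk : fnorm (P k) <= D.
    by rewrite -(subr0 (P k)); exact: diamP diamPset _ _ _ _.
  have Bk : fnorm (B k) <= D + fnorm ((2^-1)%:M : 'M[R]_n).
    rewrite -{1}(subrK ((2^-1)%:M) (B k)); apply: le_trans (ler_fnormD _ _) _.
    by rewrite lerD2r; exact: diamP diamBset _ _ _ _.
  rewrite opprB.
  apply: (projected_gradient_regret (ltW eta_gt0) cvxP cvxB pP SP' pB SB').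
    by apply: feedback_linearized => //; [exact: smooth.1 | exact: ltW].
  by have := feedback_grad_bounded L_gt0 omega_gt0 tau_gt0 smooth Pk Bk den0.
rewrite -sumrB mulr_sumr.
have := @ler_sum_nat R 1 K.+1 _ _ step.
rewrite big_split/= sumrN telescope_sumr// sumr_const_nat subn1/= => regret.
apply: le_trans regret _; rewrite [K%:R * _]mulr_natl lerD2r opprB.
apply: (@le_trans _ _ (Phi 1)).
  by rewrite lerBlDr lerDl addr_ge0 ?sqr_ge0.
case: run => _ P1 B1 _; rewrite mulrDl mul1r.
rewrite lerD// ler_pXn2r ?nnegrE ?fnorm_ge0//.
  exact: diamP diamPset _ _ _ _.
exact: diamP diamBset _ _ _ _.
Qed.

End Regret.

End Run.

(** * Decrease of the potential *)

(** The discrete form of [a' <= - s * a ^+ 2 / a 1], whose solutions satisfy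
    [a 1 / a k >= 1 + \sum s]. Stated without division, it covers the case
    where [a] vanishes. *)
Lemma quadratic_decrease (R : realType) (a s : nat -> R) (K : nat) :
  0 < a 1 -> (forall k, (1 <= k <= K.+1)%N -> 0 <= a k) ->
  (forall k, (1 <= k <= K)%N -> 0 <= s k) ->
  (forall k, (1 <= k <= K)%N -> a 1 * (a k - a k.+1) >= s k * a k ^+ 2) ->
  a K.+1 * (1 + \sum_(1 <= k < K.+1) s k) <= a 1.
Proof.
move=> a1; elim: K => [|K IH] a0 s0 dec; first by rewrite big_geq// addr0 mulr1.
have {}IH : a K.+1 * (1 + \sum_(1 <= k < K.+1) s k) <= a 1.
  apply: IH => k /andP[k1 kK].
  - by apply: a0; rewrite k1 leqW.
  - by apply: s0; rewrite k1 leqW.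
  - by apply: dec; rewrite k1 leqW.
rewrite big_nat_recr//=.
have S0 : 0 <= \sum_(1 <= k < K.+1) s k.
  rewrite big_nat_cond; apply: sumr_ge0 => k /andP[/andP[k1 kK] _].
  by apply: s0; rewrite k1 ltnW.
set S := \sum_(1 <= k < K.+1) s k in IH S0 *.
have := dec K.+1; rewrite leqnn => /(_ isT).
have : 0 <= a K.+2 by apply: a0; rewrite leqnn.
have : 0 <= a K.+1 by apply: a0; rewrite leqnSn.
have : 0 <= s K.+1 by apply: s0; rewrite leqnn.
move: (a K.+1) (a K.+2) (s K.+1) IH => u v t IH t0 u0 v0 d.
have d' : a 1 * v <= u * (a 1 - t * u) by rewrite expr2 in d; lra.
have v_le : a 1 * v * (1 + S + t) <= u * (a 1 - t * u) * (1 + S + t).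
  by rewrite ler_wpM2r// -addrA addr_ge0// addr_ge0.
(* A negative factor forces [u = 0], and then [v <= 0]. *)
have [w0|w0] := leP 0 (a 1 - t * u); last first.
  have u00 : u = 0.
    apply/eqP; rewrite eq_le u0 andbT -(ler_nM2r w0) mul0r.
    by apply: le_trans d'; rewrite mulr_ge0// ltW.
  rewrite u00 mul0r pmulr_rle0// in d'.
  by rewrite (le_trans _ (ltW a1))// mulr_le0_ge0// addr_ge0// addr_ge0.
rewrite -(ler_pM2l a1) addrA mulrA; apply: le_trans v_le _.
have := ler_wpM2r w0 IH; have := sqr_ge0 (t * u); lra.
Qed.

Section Descent.
Variables (R : realType) (n : nat) (f : 'cV[R]_n -> R) (omega tau : R).
Hypotheses (omega_gt0 : 0 < omega) (tau_gt0 : 0 < tau).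
Hypothesis df : forall x, differentiable f x.
Hypothesis cvx : convex_function setT f.
Variable xstar : 'cV[R]_n.
Hypothesis xstar_min : argmin setT f xstar.
Variable x1 : 'cV[R]_n.
Hypothesis x1_gt : f xstar < f x1.

Let V := Vconst f omega tau (f xstar) x1.

Lemma Vconst_ge0 : 0 <= V.
Proof.
rewrite /V /Vconst; case: (Delta f x1) => // r.
rewrite le_min; apply/andP; split; apply: divr_ge0;
  rewrite ?subr_ge0 ?(ltW tau_gt0)//.
- exact: ltW.
- by rewrite mulr_ge0 ?sqr_ge0.
- by rewrite mulr_ge0// ltW.
Qed.

(** The tangent inequality towards the minimizer nearest to [x]. *)
Lemma gap_le_grad_dist x r : f x <= f x1 -> Delta f x1 = r%:E ->
  f x - f xstar <= fnorm (grad f x) * r.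
Proof.
move=> xx1 Dr.
have cf : continuous f by move=> z; exact: differentiable_continuous (df z).
have [y ymin] :=
  nearest_point x (closed_argmin cf xstar_min) (ex_intro _ _ xstar_min).
have xy : fnorm (x - y) <= r.
  rewrite -lee_fin -Dr -(minvalE ymin); apply: ereal_sup_ubound.
  by exists x.
have fy : f y <= f xstar by apply: ymin.1.2.
have := convex_above_tangent y cvx (df x); rewrite -[y - x]opprB innerNr.
have := Cauchy_Schwarz (grad f x) (x - y).
have := ler_wpM2l (fnorm_ge0 (grad f x)) xy.
lra.
Qed.

(** The gap of the potential is [u + v] with [u = f x - f xstar] and
    [v = omega / 2 * fnorm (x - xm) ^+ 2]. The first bound in [V] controls
    [u ^+ 2] by the squared gradient, the second one controls [v ^+ 2] by the
    momentum term, because [v] is at most the initial gap. *)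
Lemma gap_sqr_le_denom x xm : potential f omega x xm <= f x1 ->
  V * (potential f omega x xm - f xstar) ^+ 2
  <= (f x1 - f xstar) * hb_denom f tau x xm.
Proof.
have V0 := Vconst_ge0; move=> pot_le.
have u0 : 0 <= f x - f xstar by rewrite subr_ge0; exact: xstar_min.2.
have v0 : 0 <= omega / 2 * fnorm (x - xm) ^+ 2.
  by rewrite mulr_ge0 ?sqr_ge0// divr_ge0// ltW.
have g0 : 0 <= fnorm (grad f x) by exact: fnorm_ge0.
have a0 : 0 < f x1 - f xstar by rewrite subr_gt0.
have xx1 : f x <= f x1 by apply: le_trans pot_le; rewrite lerDl.
have V_tau : V * (4 * omega) <= tau.
  rewrite -ler_pdivlMr ?mulr_gt0// /V /Vconst; case: (Delta f x1) => [r||].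
  - by rewrite ge_min lexx orbT.
  - by rewrite divr_ge0 ?mulr_ge0 ?ltW.
  - by rewrite divr_ge0 ?mulr_ge0 ?ltW.
have V_u : 4 * (V * (f x - f xstar) ^+ 2)
    <= (f x1 - f xstar) * fnorm (grad f x) ^+ 2.
  move: V0; rewrite /V /Vconst.
  case Dr : (Delta f x1) => [r||] V0; last 2 first.
  - by rewrite mul0r mulr0 mulr_ge0 ?sqr_ge0// ltW.
  - by rewrite mul0r mulr0 mulr_ge0 ?sqr_ge0// ltW.
  have ur := gap_le_grad_dist xx1 Dr.
  have u2 : (f x - f xstar) ^+ 2 <= fnorm (grad f x) ^+ 2 * r ^+ 2.
    by rewrite -exprMn ler_pXn2r ?nnegrE//; exact: le_trans ur.
  have Vr : Num.min ((f x1 - f xstar) / (4 * r ^+ 2)) (tau / (4 * omega))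
      * (4 * r ^+ 2) <= f x1 - f xstar.
    have [->|r0] := eqVneq r 0; first by rewrite expr0n/= !mulr0 ltW.
    have r2 : 0 < 4 * r ^+ 2 by rewrite mulr_gt0// exprn_even_gt0.
    by rewrite -ler_pdivlMr// ge_min lexx.
  move: (Num.min _ _) V0 Vr => W W0 Wr.
  have := ler_wpM2l W0 u2; have := ler_wpM2r (sqr_ge0 (fnorm (grad f x))) Wr.
  lra.
rewrite /potential in pot_le *; rewrite /hb_denom.
set e := fnorm (x - xm) ^+ 2 in v0 pot_le *.
have -> : f x + omega / 2 * e - f xstar = (f x - f xstar) + omega / 2 * e.
  by ring.
have v_le : omega / 2 * e <= f x1 - f xstar by lra.
have e0 : 0 <= e by exact: sqr_ge0.
have Vv := ler_wpM2l V0 (ler_wpM2r v0 v_le).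
have Vt := ler_wpM2r (mulr_ge0 e0 (ltW a0)) V_tau.
(* [(u + v) ^+ 2 <= 2 * u ^+ 2 + 2 * v ^+ 2] *)
have sq := mulr_ge0 V0 (sqr_ge0 ((f x - f xstar) - omega / 2 * e)).
have te := mulr_ge0 (mulr_ge0 (ltW tau_gt0) e0) (ltW a0).
have ag := mulr_ge0 (ltW a0) (sqr_ge0 (fnorm (grad f x))).
lra.
Qed.

Section Run.
Variables (Pset Bset : set 'M[R]_n) (eta : R) (K : nat).
Variables (x xm : nat -> 'cV[R]_n) (P B : nat -> 'M[R]_n).
Hypothesis run : HDM_HB f omega tau Pset Bset eta eta K x xm P B.
Hypothesis den_neq0 : forall k : nat, (1 <= k <= K)%N ->
  hb_denom f tau (x k) (xm k) != 0.
Hypothesis x1E : x 1%N = x1.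

Let h k := hb_feedback f omega tau (x k) (xm k) (P k) (B k).
Let psi k := potential f omega (x k) (xm k).

(** The argmin step takes the better of staying, which changes nothing, and
    moving, which changes the potential by [h k] times the denominator. *)
Lemma potential_decrease k : (1 <= k <= K)%N ->
  Num.max (- h k) 0 * hb_denom f tau (x k) (xm k) <= psi k - psi k.+1.
Proof.
move=> kK; have [_ _ _ /(_ k kK) [_ _ [_ min_psi]]] := run.
have := min_psi _ (or_introl (erefl _)).
have := min_psi _ (or_intror (erefl _)) => /=.
rewrite -/(psi k) -/(psi k.+1) => psi_step psi_stay.
have hE : - h k * hb_denom f tau (x k) (xm k)
    = psi k - potential f omega (hb_step f (x k) (xm k) (P k) (B k)) (x k).
  by rewrite mulNr /h /hb_feedback divfK ?den_neq0// opprB.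
rewrite maxr_pMl ?hb_denom_ge0// mul0r ge_max hE subr_ge0 psi_stay andbT.
by rewrite lerD2l lerN2.
Qed.

Let psi1 : psi 1%N = f x1.
Proof.
case: run => xm1 _ _ _.
by rewrite /psi /potential xm1 subrr fnorm0 expr0n mulr0 addr0 x1E.
Qed.

Lemma potential_run_le k : (1 <= k <= K.+1)%N -> psi k <= f x1.
Proof.
elim: k => // -[|k] IH /andP[_ kK]; first by rewrite psi1.
have k1 : (1 <= k.+1 <= K)%N by [].
apply: le_trans (IH _); last exact: ltnW.
rewrite -subr_ge0; apply: le_trans (potential_decrease k1).
by rewrite mulr_ge0 ?hb_denom_ge0// le_max lexx orbT.
Qed.

Lemma gap_run_le :
  (f (x K.+1) - f xstar) * (1 + V * \sum_(1 <= k < K.+1) Num.max (- h k) 0)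
  <= f x1 - f xstar.
Proof.
have f_le_psi k : f (x k) <= psi k.
  by rewrite /psi /potential lerDl mulr_ge0 ?sqr_ge0// divr_ge0// ltW.
have pos k : 0 <= Num.max (- h k) 0 by rewrite le_max lexx orbT.
have := @quadratic_decrease R
  (fun k => psi k - f xstar) (fun k => V * Num.max (- h k) 0) K.
rewrite psi1 -mulr_sumr => main; apply: le_trans (main _ _ _ _).
- rewrite ler_wpM2r ?lerD2r ?f_le_psi//.
  by rewrite addr_ge0// mulr_ge0 ?Vconst_ge0// sumr_ge0.
- by rewrite subr_gt0.
- move=> k _; rewrite subr_ge0; apply: le_trans (f_le_psi k).
  exact: xstar_min.2.
- by move=> k _; rewrite mulr_ge0 ?Vconst_ge0.
move=> k kK; rewrite opprB addrA subrK.
have psik : psi k <= f x1.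
  by apply: potential_run_le; case/andP: kK => -> /leqW.
have := ler_wpM2l (pos k) (gap_sqr_le_denom psik).
have a0 : 0 <= f x1 - f xstar by rewrite subr_ge0 ltW.
have := ler_wpM2l a0 (potential_decrease kK).
rewrite -/(psi k) -/V; lra.
Qed.

End Run.

End Descent.

Theorem theorem4p1 (R : realType) (n : nat) (L D omega tau : R)
    (L_gt0 : 0 < L) (omega_gt0 : 0 < omega) (tau_gt0 : 0 < tau) :
  exists C : R,
  forall (f : 'cV[R]_n -> R) (xstar : 'cV[R]_n) (Pset Bset : set 'M[R]_n),
    convex_function setT f -> L_smooth L f -> argmin setT f xstar ->
    closed Pset -> convex_set Pset -> closed Bset -> convex_set Bset ->
    Pset 0 -> Pset (L^-1)%:M -> (diam Pset <= D%:E)%E ->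
    Bset (2^-1)%:M -> (diam Bset <= D%:E)%E ->
  forall K : nat, (1 <= K)%N ->
  exists2 eta : R, 0 < eta &
  forall (x xm : nat -> 'cV[R]_n) (P B : nat -> 'M[R]_n),
    HDM_HB f omega tau Pset Bset eta eta K x xm P B ->
    f xstar < f (x 1%N) ->
    (forall k : nat, (1 <= k <= K)%N -> hb_denom f tau (x k) (xm k) != 0) ->
  let gammaK := gamma_star f omega tau Pset Bset K x xm in
  let rhoK := regret f omega tau Pset Bset K x xm P B in
  let V := Vconst f omega tau (f xstar) (x 1%N) in
  rhoK <= C * Num.sqrt K%:R /\
  f (x K.+1) - f xstar <=
    (f (x 1%N) - f xstar) / (K%:R * V * Num.max (gammaK - rhoK / K%:R) 0 + 1).
Proof.
pose b := D + fnorm ((2^-1)%:M : 'M[R]_n).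
pose G2 := feedback_grad_bound L omega tau D b.
exists (D ^+ 2 + G2 / 2).
move=> f xstar Pset Bset cvx smooth xstar_min clP cvxP clB cvxB P0 _ dP BI dB.
move=> K K1; have K0 : 0 < K%:R :> R by rewrite ltr0n.
exists (Num.sqrt K%:R)^-1; first by rewrite invr_gt0 sqrtr_gt0.
move=> x xm P B run x1_gt den_neq0 gammaK rhoK V.
pose H k := hb_feedback f omega tau (x k) (xm k).
pose F Q := \sum_(1 <= k < K.+1) H k Q.1 Q.2.
have [Q Qmin] : exists Q, argmin (Pset `*` Bset) F Q.
  apply: compact_argmin.
  - by exists (0, (2^-1)%:M).
  - apply: compact_setX; [apply: (closed_fnorm_bounded_compact (M := D) clP)|
      apply: (closed_fnorm_bounded_compact (M := b) clB)] => A SA.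
    + by rewrite -(subr0 A); exact: diamP dP _ _ _ _.
    + rewrite -(subrK (2^-1)%:M A); apply: le_trans (ler_fnormD _ _) _.
      by rewrite lerD2r; exact: diamP dB _ _ _ _.
  - by apply: continuous_sumr => k; exact: continuous_feedback smooth _ _.
have rhoE : rhoK = \sum_(1 <= k < K.+1) H k (P k) (B k) - F Q.
  by rewrite /rhoK /regret (minvalE Qmin).
have gammaE : gammaK = - (K%:R^-1 * F Q).
  have c0 : 0 <= K%:R^-1 :> R by rewrite invr_ge0 ltW.
  by rewrite /gammaK /gamma_star (minvalE (argmin_scale c0 Qmin)).
split.
  have s0 : 0 < Num.sqrt K%:R :> R by rewrite sqrtr_gt0.
  have eta0 : 0 < (Num.sqrt K%:R)^-1 :> R by rewrite invr_gt0.
  have := regret_against L_gt0 omega_gt0 tau_gt0 smooth cvx cvxP cvxB P0 BI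
    dP dB eta0 run den_neq0 Qmin.1.1 Qmin.1.2.
  rewrite -/b -/G2 -/(H _) -rhoE.
  have -> : K%:R * ((Num.sqrt K%:R)^-1 ^+ 2 * G2) = G2.
    by rewrite mulrA exprVn sqr_sqrtr ?(ltW K0)// divff ?mul1r// gt_eqF.
  rewrite mulrAC ler_pdivrMr//; lra.
(* The minimum of the total feedback cancels. *)
have avgE : gammaK - rhoK / K%:R =
    K%:R^-1 * \sum_(1 <= k < K.+1) - H k (P k) (B k).
  by rewrite rhoE gammaE sumrN; field; rewrite gt_eqF.
have V0 : 0 <= V by exact: Vconst_ge0.
have gap := gap_run_le omega_gt0 tau_gt0 smooth.1 cvx xstar_min x1_gt run
  den_neq0 (erefl _).
have maxle : K%:R * V * Num.max (gammaK - rhoK / K%:R) 0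
   <= V * \sum_(1 <= k < K.+1) Num.max (- H k (P k) (B k)) 0.
  rewrite mulrAC mulrC ler_wpM2l// mulrC -ler_pdivlMr// ge_max.
  apply/andP; split.
    rewrite avgE mulrC ler_wpM2r ?invr_ge0 ?(ltW K0)//.
    by apply: ler_sum => k _; rewrite le_max lexx.
  by rewrite divr_ge0 ?(ltW K0)// sumr_ge0// => k _; rewrite le_max lexx orbT.
have den1 : 0 < K%:R * V * Num.max (gammaK - rhoK / K%:R) 0 + 1.
  by rewrite ltr_wpDl// !mulr_ge0// le_max lexx orbT.
rewrite ler_pdivlMr//; apply: le_trans gap.
apply: ler_wpM2l; last by rewrite addrC lerD2l.
by rewrite subr_ge0; exact: xstar_min.2.
Qed.
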